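(* Let $\lambda,\mu>0$ and let $\{N(t);t\ge 0\}$ be the birth-death process on $\mathbb{Z}$ with transition rates $\lambda$ from each even state to each of its two neighbours and $\mu$ from each odd state to each of its two neighbours, with transition probabilities $p_{k,n}(t)=P\{N(t)=n\mid N(0)=k\}$. For $k\in\mathbb{Z}$, $t\ge0$ and real $z\neq0$ define $$F_k(z,t)=\sum_{j=-\infty}^{+\infty}z^{2j}p_{k,2j}(t),\qquad G_k(z,t)=\sum_{j=-\infty}^{+\infty}z^{2j+1}p_{k,2j+1}(t),\qquad h(z)=\sqrt{(\mu z^2+\lambda)(\lambda z^2+\mu)}.$$ Then for every $k\in\mathbb{Z}$, $t\ge0$ and real $z\ne0$: $$F_{2k}(z,t)=e^{-(\lambda+\mu)t}\frac{z^{2k}}{h(z)}\left\{h(z)\cosh\left[\frac{t\,h(z)}{z}\right]+z(\mu-\lambda)\sinh\left[\frac{t\,h(z)}{z}\right]\right\},$$ $$G_{2k}(z,t)=e^{-(\lambda+\mu)t}\frac{z^{2k}}{h(z)}\,\lambda(z^2+1)\sinh\left[\frac{t\,h(z)}{z}\right],$$ $$F_{2k+1}(z,t)=e^{-(\lambda+\mu)t}\frac{z^{2k+1}}{h(z)}\,\mu(z^2+1)\sinh\left[\frac{t\,h(z)}{z}\right],$$ $$G_{2k+1}(z,t)=e^{-(\lambda+\mu)t}\frac{z^{2k+1}}{h(z)}\left\{h(z)\cosh\left[\frac{t\,h(z)}{z}\right]+z(\lambda-\mu)\sinh\left[\frac{t\,h(z)}{z}\right]\right\}.$$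
   Context: $\{N(t);t\ge0\}$ is the time-homogeneous continuous-time Markov chain on $\mathbb{Z}$ whose only allowed transitions are to nearest neighbours, with rates $\nu_{2n,2n\pm1}=\lambda$ and $\nu_{2n\pm1,2n}=\mu$ for all $n\in\mathbb{Z}$. Equivalently, its transition probabilities satisfy, for all $t\ge0$ and $n,k\in\mathbb{Z}$, $$\frac{d}{dt}p_{k,2n}(t)=\mu p_{k,2n-1}(t)-2\lambda p_{k,2n}(t)+\mu p_{k,2n+1}(t),\qquad \frac{d}{dt}p_{k,2n+1}(t)=\lambda p_{k,2n}(t)-2\mu p_{k,2n+1}(t)+\lambda p_{k,2n+2}(t),$$ with $p_{k,n}(0)=\delta_{n,k}$ (Kronecker delta). *)

(* Defs.v *)
From mathcomp Require Import all_boot all_order all_algebra.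
From mathcomp Require Import all_classical all_reals all_analysis.
Set Implicit Arguments.
Unset Strict Implicit.
Unset Printing Implicit Defensive.
Import Order.TTheory GRing.Theory Num.Theory.
Import numFieldNormedType.Exports.
Local Open Scope classical_set_scope.
Local Open Scope ring_scope.

Section MarkovChain.
Context {R : realType} {d : measure_display} {T : measurableType d}.

(* [P k] is the law of the chain started at [k], i.e. P{ . | N(0) = k}.
   Only the times [t >= 0] of [N] are ever constrained or used. *)
Definition transition_prob (P : int -> probability T R) (N : R -> T -> int)
    (t : R) (k n : int) : R :=
  fine (P k [set w | N t w = n]).

(* The time-homogeneous continuous-time Markov chain on [int] with generator
   [q]: [q k n] is the transition rate from [k] to [n] for [n != k], and
   [- q k k] is the total rate out of [k], so that
   p_{k,n}(h) = \delta_{n,k} + q k n * h + o(h) as h -> 0+.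
   In [ctmc_markov], [past] is a finite list of (time, state) constraints. *)
Record is_ctmc (q : int -> int -> R) (P : int -> probability T R)
    (N : R -> T -> int) : Prop := IsCtmc {
  ctmc_measurable : forall (t : R) (n : int), 0 <= t ->
    measurable [set w | N t w = n];
  ctmc_start : forall k : int, P k [set w | N 0 w = k] = 1%E;
  ctmc_markov : forall (k : int) (past : seq (R * int)) (s t : R) (l n : int),
    (forall e, e \in past -> 0 <= e.1 <= s) -> 0 <= s -> 0 <= t ->
    let A := [set w | forall e, e \in past -> N e.1 w = e.2]
             `&` [set w | N s w = l] in
    P k (A `&` [set w | N (s + t) w = n])
      = (P k A * P l [set w | N t w = n])%E;
  ctmc_rates : forall k n : int,
    (transition_prob P N h k n - (n == k)%:R) / h @[h --> 0^'+] --> q k n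
}.

End MarkovChain.

Section AlternatingRates.
Context {R : realType}.
Variables lambda mu : R.

(* Rate from each state to each of its two neighbours. *)
Definition alt_rate (k : int) : R := if (2 %| k)%Z then lambda else mu.

Definition alt_generator (k n : int) : R :=
  if n == k then - (2 * alt_rate k)
  else if (n == k + 1) || (n == k - 1) then alt_rate k
  else 0.

Definition alt_h (z : R) : R :=
  Num.sqrt ((mu * z ^+ 2 + lambda) * (lambda * z ^+ 2 + mu)).

End AlternatingRates.

Section Series.
Context {R : realType}.

(* Two-sided series over [int], split at 0: both halves have to converge. *)
Definition bilateral_cvg (a : int -> R) : Prop :=
  cvgn (series (fun j : nat => a j%:Z)) /\
  cvgn (series (fun j : nat => a (- (j.+1)%:Z))).

Definition bilateral_sum (a : int -> R) : R :=
  limn (series (fun j : nat => a j%:Z)) +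
  limn (series (fun j : nat => a (- (j.+1)%:Z))).

Definition F_term (p : R -> int -> int -> R) (k : int) (z t : R) (j : int) : R :=
  z ^ (2 * j) * p t k (2 * j).

Definition G_term (p : R -> int -> int -> R) (k : int) (z t : R) (j : int) : R :=
  z ^ (2 * j + 1) * p t k (2 * j + 1).

Definition F_gen p k z t : R := bilateral_sum (F_term p k z t).
Definition G_gen p k z t : R := bilateral_sum (G_term p k z t).

Definition cosh (x : R) : R := (expR x + expR (- x)) / 2.
Definition sinh (x : R) : R := (expR x - expR (- x)) / 2.

End Series.

(* Main.v *)
Require Import Defs.
From mathcomp Require Import all_boot all_order all_algebra.
From mathcomp Require Import all_classical all_reals all_analysis.
From mathcomp Require Import zify ring lra.
Import Order.TTheory GRing.Theory Num.Theory.
Import numFieldNormedType.Exports.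
Local Open Scope classical_set_scope.
Local Open Scope ring_scope.

Set Implicit Arguments.
Unset Strict Implicit.
Unset Printing Implicit Defensive.

(* Conditioning on a short first time step turns the infinitesimal rates into
   the backward equations p_{k,n}' = r_k (p_{k+1,n} + p_{k-1,n} - 2 p_{k,n}),
   for each fixed n.  A finite generating sum over a window |n| < 2J and the
   closed formula solve the same backward equations in k, and agree at time 0
   for |k| < 2J.  Their difference is at most M_J there with M_J exponential in
   J, and a discrepancy at the boundary of the window needs about 2J - |k|
   jumps to reach k, so iterating the Duhamel bound gives |difference| <=
   M_J (C t)^J / J! -> 0.  No a priori tail estimate on the chain, and no
   termwise differentiation of a series, is involved. *)

(** * Splitting a probability along three disjoint events *)

Section ThreeDisjointEvents.
Context {R : realType} {d : measure_display} {T : measurableType d}.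
Variable P : probability T R.

Lemma fine_probability_ge0 (A : set T) : 0 <= fine (P A).
Proof. by rewrite fine_ge0. Qed.

Lemma fine_probability_le1 (A : set T) : measurable A -> fine (P A) <= 1.
Proof.
move=> mA; rewrite -lee_fin fineK ?probability_le1//.
exact: fin_num_measure.
Qed.

Lemma fine_probabilityDI (A B : set T) : measurable A -> measurable B ->
  fine (P A) = fine (P (A `\` B)) + fine (P (A `&` B)).
Proof.
move=> mA mB; rewrite {1}(measureDI P mA mB) fineD//; apply: fin_num_measure.
  exact: measurableD.
exact: measurableI.
Qed.

(** Removing the three events from [A] one after another splits [fine (P A)] exactly. Disjointness
    leaves each removed piece intact, and the remainder is nonnegative. *)
Lemma fine_probability_sum3_le (A B1 B2 B3 : set T) :
  measurable A -> measurable B1 -> measurable B2 -> measurable B3 ->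
  B1 `&` B2 = set0 -> B1 `&` B3 = set0 -> B2 `&` B3 = set0 ->
  fine (P (A `&` B1)) + fine (P (A `&` B2)) + fine (P (A `&` B3))
    <= fine (P A).
Proof.
move=> mA m1 m2 m3 d12 d13 d23.
have m1' := measurableD mA m1; have m2' := measurableD m1' m2.
rewrite (fine_probabilityDI mA m1) (fine_probabilityDI m1' m2)
  (fine_probabilityDI m2' m3).
have -> : (A `\` B1) `&` B2 = A `&` B2.
  apply/seteqP; split=> x [] => [[]//|Ax Bx]; split=> //; split=> // B1x.
  by have : (B1 `&` B2) x by []; rewrite d12.
have -> : ((A `\` B1) `\` B2) `&` B3 = A `&` B3.
  apply/seteqP; split=> x [] => [[[]]//|Ax Bx]; split=> //; split=> //.
    by split=> // B1x; have : (B1 `&` B3) x by []; rewrite d13.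
  by move=> B2x; have : (B2 `&` B3) x by []; rewrite d23.
have := fine_probability_ge0 (((A `\` B1) `\` B2) `\` B3); lra.
Qed.

End ThreeDisjointEvents.

(** * From infinitesimal rates to the backward equations *)

Section BackwardEquation.
Context {R : realType} {d : measure_display} {T : measurableType d}.
Variables (lambda mu : R) (P : int -> probability T R) (N : R -> T -> int).
Hypothesis N_ctmc : is_ctmc (alt_generator lambda mu) P N.

Local Notation p := (transition_prob P N).
Local Notation r := (alt_rate lambda mu).

Let event (t : R) (n : int) : set T := [set w | N t w = n].

Let event_disjoint (t : R) (m n : int) :
  m != n -> event t m `&` event t n = set0.
Proof.
move=> mn; apply/seteqP; split=> x //= [Nm Nn].
by move: mn; rewrite -Nm -Nn eqxx.
Qed.

Lemma transition_prob_ge0 (t : R) (k n : int) : 0 <= p t k n.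
Proof. exact: fine_probability_ge0. Qed.

Lemma transition_prob_le1 (t : R) (k n : int) : 0 <= t -> p t k n <= 1.
Proof.
move=> t0; apply: fine_probability_le1; exact: (ctmc_measurable N_ctmc).
Qed.

(** Starting at [k] has full measure, and any other initial state lies in the null complement. *)
Lemma transition_prob0 (k n : int) : p 0 k n = (n == k)%:R.
Proof.
have [->|nk] := eqVneq n k.
  by rewrite /transition_prob (ctmc_start N_ctmc).
have mk := ctmc_measurable N_ctmc k (lexx 0).
have mn := ctmc_measurable N_ctmc n (lexx 0).
have := fine_probabilityDI (P k) (measurableT : measurable [set: T]) mk.
rewrite probability_setT setTI setTD (ctmc_start N_ctmc) /= => PC.
have {}PC : fine (P k (~` event 0 k)) = 0 by rewrite /event; lra.
apply/eqP; rewrite eq_le transition_prob_ge0 andbT /=.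
apply: (@le_trans _ _ (fine (P k (~` event 0 k)))); last by rewrite PC.
apply: fine_le.
- exact: fin_num_measure.
- by apply: fin_num_measure; exact: measurableC.
- apply: le_measure; rewrite ?inE//; first exact: measurableC.
  by move=> x; rewrite /event /= => Nn Nk; move: nk; rewrite -Nn -Nk eqxx.
Qed.

Lemma transition_prob_joint (k l n : int) (s t : R) : 0 <= s -> 0 <= t ->
  fine (P k (event s l `&` event (s + t) n)) = p s k l * p t l n.
Proof.
move=> s0 t0.
have := @ctmc_markov _ _ _ _ _ _ N_ctmc k [::] s t l n.
have -> : [set w | forall e : R * int, e \in [::] -> N e.1 w = e.2] `&`
  [set w | N s w = l] = event s l.
  by apply/seteqP; split => x //= [].
move=> -> //; rewrite fineM//; apply: fin_num_measure.
  exact: (ctmc_measurable N_ctmc).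
exact: (ctmc_measurable N_ctmc).
Qed.

(* Conditioning on [N h]: paths leaving {k - 1, k, k + 1} by time [h] are
   treated as an error term. *)
Lemma transition_prob_step (k n : int) (h s : R) : 0 <= h -> 0 <= s ->
  0 <= p (h + s) k n - (p h k k * p s k n + p h k (k + 1) * p s (k + 1) n +
                        p h k (k - 1) * p s (k - 1) n)
    <= 1 - (p h k k + p h k (k + 1) + p h k (k - 1)).
Proof.
move=> h0 s0; have hs0 : 0 <= h + s by rewrite addr_ge0.
have mE t m : 0 <= t -> measurable (event t m).
  by move=> ?; exact: (ctmc_measurable N_ctmc).
have d1 : k != k + 1 by apply/eqP; lia.
have d2 : k != k - 1 by apply/eqP; lia.
have d3 : k + 1 != k - 1 by apply/eqP; lia.
have mB := mE _ n hs0.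
have := fine_probability_sum3_le (P k) mB (mE h k h0) (mE h (k + 1) h0)
  (mE h (k - 1) h0) (event_disjoint h d1) (event_disjoint h d2)
  (event_disjoint h d3).
(* The complement of the event at time [h + s] gives the upper bound, the event itself the lower
   one. *)
have := fine_probability_sum3_le (P k) (measurableC mB) (mE h k h0)
  (mE h (k + 1) h0)
  (mE h (k - 1) h0) (event_disjoint h d1) (event_disjoint h d2)
  (event_disjoint h d3).
have EI m : fine (P k (~` event (h + s) n `&` event h m)) =
    p h k m - p h k m * p s m n.
  rewrite -transition_prob_joint// {1}/transition_prob.
  by rewrite (fine_probabilityDI (P k) (mE h m h0) mB) addrK setDE setIC.
have EJ m : fine (P k (event (h + s) n `&` event h m)) = p h k m * p s m n.
  by rewrite setIC transition_prob_joint.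
have EC : fine (P k (~` event (h + s) n)) = 1 - p (h + s) k n.
  have := fine_probabilityDI (P k) (measurableT : measurable [set: T]) mB.
  by rewrite probability_setT setTI setTD/= => ->; rewrite addrK.
rewrite !EI !EJ EC.
by rewrite -/(p (h + s) k n) => H1 H2; apply/andP; split; lra.
Qed.

Lemma transition_prob_rate (k n : int) (e : R) : 0 < e ->
  exists2 dlt : R, 0 < dlt & forall h, 0 < h < dlt ->
    `|p h k n - (n == k)%:R - h * alt_generator lambda mu k n| <= e * h.
Proof.
move=> e0; have /cvgrPdist_le/(_ e e0) :=
  @ctmc_rates _ _ _ _ _ _ N_ctmc k n.
move=> [dlt /= d0 H]; exists dlt => // h /andP[h0 hd].
have : ball_ [eta Num.norm] 0 dlt h by rewrite /= sub0r normrN gtr0_norm.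
move=> /H/(_ h0); rewrite distrC => He.
rewrite (_ : _ - _ - _ = ((p h k n - (n == k)%:R) / h -
    alt_generator lambda mu k n) * h); last by field; rewrite gt_eqF.
by rewrite normrM (gtr0_norm h0) ler_pM2r.
Qed.

(** The step size [dlt] is independent of [s] because it comes from the rates at time 0 alone; the
    probabilities at time [s] enter only as factors in [0, 1]. *)
Lemma backward_equation_uniform (k n : int) (e : R) : 0 < e ->
  exists2 dlt : R, 0 < dlt & forall s h, 0 <= s -> 0 < h < dlt ->
    `|p (s + h) k n - p s k n -
      h * (r k * (p s (k + 1) n + p s (k - 1) n - 2 * p s k n))| <= e * h.
Proof.
(* Six errors share [e]: three rate errors bounding the escape term [D], and the same three weighted
   by probabilities. *)
move=> e0; have e6 : 0 < e / 6 by rewrite divr_gt0.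
have [d1 d1gt0 H1] := transition_prob_rate k k e6.
have [d2 d2gt0 H2] := transition_prob_rate k (k + 1) e6.
have [d3 d3gt0 H3] := transition_prob_rate k (k - 1) e6.
exists (Num.min d1 (Num.min d2 d3)); first by rewrite !lt_min d1gt0 d2gt0.
move=> s h s0 /andP[h0]; rewrite !lt_min => /and3P[hd1 hd2 hd3].
have := H1 h; have := H2 h; have := H3 h; rewrite h0 hd1 hd2 hd3.
rewrite /alt_generator !eqxx.
have -> : (k + 1 == k) = false by apply/eqP; lia.
have -> : (k - 1 == k) = false by apply/eqP; lia.
rewrite orbT !subr0 /=.
have := transition_prob_step k n (ltW h0) s0; rewrite (addrC h).
have b0 := transition_prob_le1 k n s0; have b0' := transition_prob_ge0 s k n.
have b1 := transition_prob_le1 (k + 1) n s0.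
have b1' := transition_prob_ge0 s (k + 1) n.
have b2 := transition_prob_le1 (k - 1) n s0.
have b2' := transition_prob_ge0 s (k - 1) n.
move: (p s k n) b0 b0' => x0 b0 b0'.
move: (p s (k + 1) n) b1 b1' => x1 b1 b1'.
move: (p s (k - 1) n) b2 b2' => x2 b2 b2'.
move: (p (s + h) k n) (p h k k) (p h k (k + 1)) (p h k (k - 1)) => y c0 c1 c2.
move=> /andP[D0 D1] /(_ isT) E2 /(_ isT) E1 /(_ isT) E0.
rewrite !mulrN opprK in E0.
set f0 := c0 - 1 + _ in E0; set f1 := c1 - _ in E1; set f2 := c2 - _ in E2.
set D := y - _ in D0 D1.
have -> : y - x0 - h * (r k * (x1 + x2 - 2 * x0)) =
   D + (f0 * x0 + f1 * x1 + f2 * x2).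
  by rewrite /D /f0 /f1 /f2; ring.
(* The generator row sums to zero, so the mass outside the three states is the negated sum of the
   rate errors. *)
have D1' : D <= - (f0 + f1 + f2) by rewrite (le_trans D1)// /f0 /f1 /f2; lra.
have fx f x : `|f| <= e / 6 * h -> 0 <= x -> x <= 1 -> `|f * x| <= e / 6 * h.
  move=> fe x0' x1'; rewrite normrM (ger0_norm x0'); apply: le_trans fe.
  by rewrite ler_piMr.
have := fx _ _ E0 b0' b0; have := fx _ _ E1 b1' b1; have := fx _ _ E2 b2' b2.
move: E0 E1 E2; rewrite !ler_norml.
move=> /andP[? ?] /andP[? ?] /andP[? ?] /andP[? ?] /andP[? ?] /andP[? ?].
by apply/andP; split; lra.
Qed.

End BackwardEquation.

(** * Upgrading a uniform right derivative to a two-sided one *)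

Section UniformRightDerivative.
Context {R : realType}.

(* Transition probabilities carry no information at negative times. *)
Definition freeze_negative_times (f : R -> R) : R -> R :=
  fun t => f (Num.max t 0).

Variables f g : R -> R.
Hypothesis f_uniform : forall e : R, 0 < e ->
  exists2 dlt : R, 0 < dlt & forall s h : R, 0 <= s -> 0 < h < dlt ->
    `|f (s + h) - f s - h * g s| <= e * h.

(** With [e = 1] the hypothesis makes [f] Lipschitz with constant [1 + K] across increments below
    [dlt], and truncation at 0 does not increase distances. *)
Lemma uniform_right_derivative_continuous (K : R) :
  (forall s, 0 <= s -> `|g s| <= K) ->
  continuous (freeze_negative_times f).
Proof.
move=> gK; have [dlt d0 H] := f_uniform ltr01.
have K0 : 0 <= K by rewrite (le_trans _ (gK 0 (lexx _))).
have K1 : 0 < 1 + K by rewrite ltr_wpDr.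
have lip x y : 0 <= x -> x <= y -> y - x < dlt ->
    `|f y - f x| <= (1 + K) * (y - x).
  move=> x0; rewrite le_eqVlt => /predU1P[->|xy yx].
    by rewrite !subrr normr0 mulr0.
  have yx0 : 0 < y - x by rewrite subr_gt0.
  have := H x (y - x) x0; rewrite yx0 yx subrKC => /(_ isT) Hx.
  rewrite (_ : f y - f x = (f y - f x - (y - x) * g x) + (y - x) * g x);
    last by rewrite subrK.
  rewrite (le_trans (ler_normD _ _))// [leRHS]mulrDl lerD// normrM gtr0_norm//.
  by rewrite mulrC ler_wpM2r ?(ltW yx0)// gK.
move=> t; apply/cvgrPdist_le => e e0.
apply/nbhs_ballP; exists (Num.min dlt (e / (1 + K))) => /= [|u].
  by rewrite lt_min d0 divr_gt0.
rewrite /ball/= lt_min => /andP[tud]; rewrite ltr_pdivlMr// => tue.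
rewrite /freeze_negative_times.
have x0 : 0 <= Num.max t 0 by rewrite le_max lexx orbT.
have y0 : 0 <= Num.max u 0 by rewrite le_max lexx orbT.
have D : `|Num.max t 0 - Num.max u 0| <= `|t - u|.
  have [t0|t0] := leP t 0; have [u0|u0] := leP u 0.
  - by rewrite subrr normr0.
  - by rewrite sub0r normrN distrC !gtr0_norm//; lra.
  - by rewrite subr0 !gtr0_norm//; lra.
  - by [].
move: (Num.max t 0) (Num.max u 0) x0 y0 D => x y x0 y0 D.
suff : `|f x - f y| <= (1 + K) * `|x - y|.
  move=> /le_trans; apply; apply: le_trans (ltW tue).
  by rewrite mulrC ler_wpM2r// ltW.
have Dd := le_lt_trans D tud.
have [xy|/ltW yx] := leP x y.
  move: Dd; rewrite (distrC (f x)) (distrC x) ger0_norm ?subr_ge0//.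
  exact: lip.
by move: Dd; rewrite ger0_norm ?subr_ge0//; exact: lip.
Qed.

(** Uniformity in the base point handles left increments: for [h < 0] the hypothesis is applied at
    [h + s] with step [- h], and continuity of [g] replaces [g (h + s)] by [g s]. *)
Lemma uniform_right_derivative_is_derive (s : R) : 0 < s ->
  continuous (freeze_negative_times g) ->
  is_derive s 1 (freeze_negative_times f) (g s).
Proof.
move=> s0 gc.
suff fs : h^-1 *: ((freeze_negative_times f \o shift s) (h *: (1 : R)) -
    freeze_negative_times f s) @[h --> (0:R)^'] --> (g s : R).
  by apply: DeriveDef; [apply/cvg_ex; exists (g s) | exact: cvg_lim].
apply/cvgrPdist_le => e e0.
have e2 : 0 < e / 2 by rewrite divr_gt0.
have [dlt d0 H] := f_uniform e2.
have /cvgrPdist_le/(_ _ e2)/nbhs_ballP[d' /= d'0 H'] := gc s.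
(* Increments below [s] keep [h + s] positive, where freezing changes nothing. *)
exists (Num.min s (Num.min dlt d')) => /= [|h]; first by rewrite !lt_min s0 d0.
rewrite /= sub0r normrN !lt_min => /and3P[hs hd hd'] h0.
rewrite /freeze_negative_times /shift /= /GRing.scale /= mulr1.
have hs0 : 0 < h + s.
  by move: hs; rewrite ltr_norml => /andP[]; lra.
rewrite (max_l (ltW hs0)) (max_l (ltW s0)).
have key : `|f (h + s) - f s - h * g s| <= e * `|h|.
  have [hp|hn|h00] := ltgtP h 0; last by rewrite h00 eqxx in h0.
  - rewrite (ltr0_norm hp) in hd hd' *.
    have := H (h + s) (- h) (ltW hs0); rewrite oppr_gt0 hp hd => /(_ isT).
    rewrite (_ : h + s - h = s); last by ring.
    have hb : ball s d' (h + s).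
      by rewrite /ball/= (_ : s - (h + s) = - h) ?normrN ?ltr0_norm//; ring.
    have := H' _ hb.
    rewrite /freeze_negative_times /= (max_l (ltW hs0)) (max_l (ltW s0)).
    move=> Hg Hf.
    rewrite (_ : _ - _ - _ = - (f s - f (h + s) - - h * g (h + s)) +
       - h * (g s - g (h + s))); last by ring.
    rewrite (le_trans (ler_normD _ _))// normrN normrM normrN (ltr0_norm hp).
    have hn0 : 0 <= - h by rewrite oppr_ge0 ltW.
    have := ler_wpM2l hn0 Hg; lra.
  - rewrite (gtr0_norm hn) in hd *.
    have := H s h (ltW s0); rewrite hn hd => /(_ isT); rewrite (addrC s).
    move=> Hf; apply: (le_trans Hf); rewrite ler_wpM2r ?(ltW hn)//; lra.
have -> : g s - h^-1 * (f (h + s) - f s) = - ((f (h + s) - f s - h * g s) / h).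
  by field.
by rewrite normrN normrM normfV ler_pdivrMr ?normr_gt0.
Qed.

End UniformRightDerivative.

(** * Iterated comparison for damped equations with a source *)

Section DelayedComparison.
Context {R : realType}.

(** The integrating factor [expR (c * s)] absorbs the damping: multiplied by it, [f] minus the
    claimed bound is nonincreasing on [0, T] and starts nonpositive. *)
Lemma damped_derive_le (f g : R -> R) (c B T : R) (m : nat) :
  0 <= c -> 0 <= B -> continuous f -> f 0 <= 0 ->
  (forall s : R, 0 < s < T -> is_derive s 1 f (g s - c * f s)) ->
  (forall s : R, 0 <= s <= T -> g s <= B * s ^+ m) ->
  forall s : R, 0 <= s <= T -> f s <= B / m.+1%:R * s ^+ m.+1.
Proof.
move=> c0 B0 fc f0 fd gB s /andP[s0 sT].
pose u : R -> R := (expR \o (c \*: id)) * (f - (B / m.+1%:R) \*: (id ^+ m.+1)).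
have ud x : 0 < x < T -> is_derive x 1 u
    (expR (c * x) * (g x - B * x ^+ m - c * (B / m.+1%:R) * x ^+ m.+1)).
  move=> xT; have fdx := fd x xT.
  apply: is_derive_eq.
  rewrite !fctE /= /GRing.scale /= exprS; field.
  by rewrite nat1r pnatr_eq0.
have uc : continuous u.
  move=> x; apply: cvgM.
    apply: continuous_comp; last exact: continuous_expR.
    by apply: cvgZr; exact: cvg_id.
  apply: cvgB; first exact: fc.
  apply: cvgZr.
  rewrite (_ : id ^+ m.+1 = (fun y : R => y ^+ m.+1)).
    exact: exprn_continuous.
  by apply/funext => y; rewrite !fctE.
have : u s <= u 0.
  have udo x : x \in `]0, T[%R -> is_derive x 1 u
    (expR (c * x) * (g x - B * x ^+ m - c * (B / m.+1%:R) * x ^+ m.+1)).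
    by rewrite in_itv/= => /ud.
  apply: (@ler0_derive1_nincr _ u 0 T) => //.
  - by move=> x /udo [].
  - move=> x xT; rewrite derive1E; have [_ ->] := udo x xT.
    move: xT; rewrite in_itv/= => /andP[x0 xT].
    have := gB x; rewrite (ltW x0) (ltW xT) => /(_ isT) gx.
    rewrite mulr_ge0_le0 ?expR_ge0//.
    have : 0 <= c * (B / m.+1%:R) * x ^+ m.+1.
      by rewrite !mulr_ge0 ?invr_ge0 ?exprn_ge0// ltW.
    by move: (c * _ * _) (B * _) gx => y1 y2; lra.
  - exact: continuous_subspaceT.
rewrite /u !fctE /= /GRing.scale /= mulr0 expR0 mul1r expr0n/= mulr0 subr0.
move=> /le_trans/(_ f0); rewrite pmulr_rle0 ?expR_gt0// subr_le0.
by [].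
Qed.

Lemma damped_derive_norm_le (f g : R -> R) (c B T : R) (m : nat) :
  0 <= c -> 0 <= B -> continuous f -> f 0 = 0 ->
  (forall s : R, 0 < s < T -> is_derive s 1 f (g s - c * f s)) ->
  (forall s : R, 0 <= s <= T -> `|g s| <= B * s ^+ m) ->
  forall s : R, 0 <= s <= T -> `|f s| <= B / m.+1%:R * s ^+ m.+1.
Proof.
move=> c0 B0 fc f0 fd gB s sT; rewrite ler_norml lerNl; apply/andP; split.
  apply: (@damped_derive_le (- f) (- g) c B T) => //.
  - by move=> x; apply: cvgN; exact: fc.
  - by rewrite !fctE f0 oppr0.
  - move=> x xT; have := fd x xT => fdx; apply: is_derive_eq.
    by rewrite !fctE; ring.
  - move=> x xT; rewrite !fctE.
    by have := gB x xT; rewrite ler_norml lerNl => /andP[].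
apply: (@damped_derive_le f g c B T) => //; first by rewrite f0.
by move=> x xT; have := gB x xT; rewrite ler_norml => /andP[].
Qed.

(* Duhamel's formula gains one factor of time at the cost of shrinking the
   window by one, as r k * W (k +- 1) is the only source term. *)
Lemma window_bound (W : int -> R -> R) (r : int -> R) (C M T : R) (J : nat) :
  (forall k, 0 <= r k <= C) -> 0 <= M ->
  (forall k, continuous (W k)) ->
  (forall k (s : R), 0 < s < T -> is_derive s 1 (W k)
    (r k * (W (k + 1) s + W (k - 1) s - 2 * W k s))) ->
  (forall k, (`|k| < J)%N -> W k 0 = 0) ->
  (forall k s, (`|k| <= J)%N -> 0 <= s <= T -> `|W k s| <= M) ->
  forall m k (s : R), (`|k| + m <= J)%N -> 0 <= s <= T ->
    `|W k s| <= M * ((2 * C) ^+ m / m`!%:R) * s ^+ m.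
Proof.
move=> rC M0 Wc Wd W0 WM; elim=> [|m IH] k s kJ sT.
  by rewrite expr0 fact0 divr1 !mulr1; apply: WM => //; lia.
have /andP[rk0 rkC] := rC k.
have C0 : 0 <= C by rewrite (le_trans rk0).
pose B := M * ((2 * C) ^+ m / m`!%:R) * (2 * C).
have B0 : 0 <= B.
  by rewrite /B !mulr_ge0 ?invr_ge0// ?exprn_ge0// mulr_ge0.
have -> : M * ((2 * C) ^+ m.+1 / (m.+1)`!%:R) * s ^+ m.+1 =
    B / m.+1%:R * s ^+ m.+1.
  rewrite /B factS natrM exprS; field.
  by rewrite ?nat1r !pnatr_eq0 -?lt0n ?fact_gt0.
(* The exit term of rate [2 * r k] acts as damping. The two neighbours, each weighted by at most
   [C], yield the factor [2 * C], and integration yields the next factor of the factorial. *)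
apply: (@damped_derive_norm_le (W k)
  (fun s => r k * (W (k + 1) s + W (k - 1) s)) (2 * r k) B T) => //.
- by rewrite mulr_ge0.
- by apply: W0; lia.
- move=> x xT; have := Wd k x xT => Wdx; apply: is_derive_eq.
  ring.
- move=> x xT.
  have H1 : `|W (k + 1) x| <= M * ((2 * C) ^+ m / m`!%:R) * x ^+ m.
    by apply: IH => //; lia.
  have H2 : `|W (k - 1) x| <= M * ((2 * C) ^+ m / m`!%:R) * x ^+ m.
    by apply: IH => //; lia.
  rewrite normrM (ger0_norm rk0) /B.
  set Q := M * _ in H1 H2 *.
  rewrite (_ : Q * (2 * C) * x ^+ m = C * (Q * x ^+ m + Q * x ^+ m));
    last by ring.
  by rewrite ler_pM// (le_trans (ler_normD _ _))// lerD.
Qed.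

End DelayedComparison.

(** * The linear space of solutions of the backward equations *)

Section BackwardSolutions.
Context {R : realType}.
Variable r : int -> R.

(** Derivatives are required only at positive times, since a function frozen on the negative axis
    may have a corner at 0; continuity there carries the initial value into the comparison. *)
Definition backward_solution (f : int -> R -> R) : Prop :=
  (forall k, continuous (f k)) /\
  (forall k (s : R), 0 < s -> is_derive s 1 (f k)
    (r k * (f (k + 1) s + f (k - 1) s - 2 * f k s))).

Lemma backward_solution0 : backward_solution (fun _ _ => 0).
Proof.
split=> [k|k s _]; first by move=> x; exact: cvg_cst.
have := is_derive_cst (0 : R) s 1 => H.
by apply: is_derive_eq; ring.
Qed.

Lemma backward_solutionD (f g : int -> R -> R) :
  backward_solution f -> backward_solution g ->
  backward_solution (fun k s => f k s + g k s).
Proof.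
move=> [fc fd] [gc gd]; split=> [k|k s s0].
  by move=> x; apply: cvgD; [exact: fc|exact: gc].
have := fd k s s0 => fds; have := gd k s s0 => gds.
apply: (@is_derive_eq _ _ _ (f k + g k)); ring.
Qed.

Lemma backward_solutionZ (a : R) (f : int -> R -> R) :
  backward_solution f -> backward_solution (fun k s => a * f k s).
Proof.
move=> [fc fd]; split=> [k|k s s0].
  by move=> x; apply: cvgZr; exact: fc.
have := fd k s s0 => fds.
apply: (@is_derive_eq _ _ _ (a \*: f k)).
rewrite /GRing.scale /=; ring.
Qed.

Lemma backward_solutionB (f g : int -> R -> R) :
  backward_solution f -> backward_solution g ->
  backward_solution (fun k s => f k s - g k s).
Proof.
move=> hf /(backward_solutionZ (-1)) /(backward_solutionD hf).
congr backward_solution; apply/funext => k; apply/funext => s.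
by rewrite mulN1r.
Qed.

End BackwardSolutions.

(** * Exponentially damped hyperbolic functions *)

Section HyperbolicSolutions.
Context {R : realType}.

Definition hyperbolic (sg H A D : R) : R -> R :=
  fun t => expR (- sg * t) * (A * cosh (t * H) + D * sinh (t * H)).

Lemma hyperbolicE (sg H A D : R) : hyperbolic sg H A D =
  ((A + D) / 2) \*: (expR \o ((H - sg) \*: id)) +
  ((A - D) / 2) \*: (expR \o ((- H - sg) \*: id)).
Proof.
apply/funext => t; rewrite !fctE /= /GRing.scale /= /hyperbolic /cosh /sinh.
rewrite (_ : (H - sg) * t = - sg * t + t * H); last by ring.
rewrite (_ : (- H - sg) * t = - sg * t + - (t * H)); last by ring.
by rewrite !expRD; field.
Qed.

(** Differentiation acts linearly on the coefficient pair [(A, D)], so the backward equations reduce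
    to identities between coefficients. *)
Lemma hyperbolic_is_derive (sg H A D t : R) :
  is_derive t 1 (hyperbolic sg H A D)
    (hyperbolic sg H (D * H - sg * A) (A * H - sg * D) t).
Proof.
rewrite !hyperbolicE; apply: is_derive_eq.
by rewrite !fctE /= /GRing.scale /=; field.
Qed.

Lemma hyperbolic_continuous (sg H A D : R) : continuous (hyperbolic sg H A D).
Proof.
move=> t; apply/differentiable_continuous/derivable1_diffP.
by have [] := hyperbolic_is_derive sg H A D t.
Qed.

End HyperbolicSolutions.

(** * The closed formulas as solutions of the backward equations *)

Section CandidateSolution.
Context {R : realType}.
Variables lambda mu : R.
Hypotheses (lambda_gt0 : 0 < lambda) (mu_gt0 : 0 < mu).
Variable z : R.
Hypothesis z_neq0 : z != 0.

Local Notation r := (alt_rate lambda mu).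
Local Notation h := (alt_h lambda mu z).

Lemma alt_rate_ge0_le (k : int) : 0 <= r k <= lambda + mu.
Proof.
by rewrite /alt_rate; have := lambda_gt0; have := mu_gt0; case: ifP => _; lra.
Qed.

(** Reading rates relative to [c] lets a single computation serve both generating functions. *)
Lemma alt_rate_parity (c k : int) :
  r k = if (2 %| (k - c))%Z then r c else r (c + 1).
Proof.
rewrite /alt_rate; do ![case: ifP] => //; lia.
Qed.

Lemma alt_rateD1 (c : int) : r c + r (c + 1) = lambda + mu.
Proof.
rewrite /alt_rate; do ![case: ifP] => //; try lia.
by move=> _ _; rewrite addrC.
Qed.

Lemma alt_h_gt0 : 0 < h.
Proof.
have pos a b : 0 < a -> 0 < b -> 0 < a * z ^+ 2 + b.
  by move=> a0 b0; rewrite ltr_wpDl// mulr_ge0 ?sqr_ge0// ltW.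
by rewrite /alt_h sqrtr_gt0 mulr_gt0 ?pos.
Qed.

(** The expanded product under the root is symmetric in the two rates, so the parity of [c] is
    immaterial. *)
Lemma alt_h_sqr (c : int) :
  h ^+ 2 = r c * r (c + 1) * (z ^+ 2 + 1) ^+ 2 +
    (r (c + 1) - r c) ^+ 2 * z ^+ 2.
Proof.
rewrite /alt_h sqr_sqrtr; last first.
  have pos a b : 0 < a -> 0 < b -> 0 <= a * z ^+ 2 + b.
    by move=> a0 b0; rewrite addr_ge0 ?(ltW b0)// mulr_ge0 ?(ltW a0) ?sqr_ge0.
  by rewrite mulr_ge0 ?pos.
by rewrite /alt_rate; do ![case: ifP] => //; try lia; move=> _ _; ring.
Qed.

(* [c] records the parity of the states retained in the generating function:
   0 for F, 1 for G. *)
Definition gen_solution (c k : int) (t : R) : R :=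
  z ^ k * (if (2 %| (k - c))%Z
    then hyperbolic (lambda + mu) (h / z) 1 (z * (r (c + 1) - r c) / h) t
    else hyperbolic (lambda + mu) (h / z) 0 (r (c + 1) * (z ^+ 2 + 1) / h) t).

Lemma gen_solution_backward (c : int) : backward_solution r (gen_solution c).
Proof.
have h0 : h != 0 by rewrite gt_eqF// alt_h_gt0.
have hE := alt_h_sqr c; have sE := alt_rateD1 c.
split=> [k|k s s0].
  rewrite /gen_solution; case: (2 %| k - c)%Z;
  by move=> x; apply: cvgM; [exact: cvg_cst | exact: hyperbolic_continuous].
rewrite /gen_solution (alt_rate_parity c k).
have -> : (2 %| k + 1 - c)%Z = ~~ (2 %| k - c)%Z by lia.
have -> : (2 %| k - 1 - c)%Z = ~~ (2 %| k - c)%Z by lia.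
rewrite !expfzDr// expr1z exprN1 -sE.
move: (r c) (r (c + 1)) hE => al be hE.
pose D := z * (be - al) / h; pose E := be * (z ^+ 2 + 1) / h.
(* Coefficient matching: [HD] and [HE] are the cosh and sinh conditions at states of the parity of
   [c], [HE'] the cosh condition at the others. Only [HE] needs the value of [h ^+ 2]. *)
have HD : D * (h / z) = be - al by rewrite /D; field; rewrite h0 z_neq0.
have HE : h / z = al * (z + z^-1) * E + (be - al) * D.
  rewrite (_ : h / z = h ^+ 2 / (h * z)); last by field; rewrite h0 z_neq0.
  by rewrite hE /D /E; field; rewrite h0 z_neq0.
have HE' : E * (h / z) = be * (z + z^-1).
  by rewrite /E; field; rewrite h0 z_neq0.
have Hdiff A B := hyperbolic_is_derive (al + be) (h / z) A B s.
rewrite -/D -/E; case: (2 %| k - c)%Z => /=.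
  apply: (@is_derive_eq _ _ _ ((z ^ k) \*: hyperbolic (al + be) (h / z) 1 D)).
  rewrite /GRing.scale /= HD mul1r /hyperbolic.
  move: (cosh _) (sinh _) => ch sh; rewrite HE.
  by move: D E {HD HE HE'} => D E; field.
apply: (@is_derive_eq _ _ _ ((z ^ k) \*: hyperbolic (al + be) (h / z) 0 E)).
rewrite /GRing.scale /= HE' mul0r /hyperbolic.
move: (cosh _) (sinh _) => ch sh.
by rewrite /D /E; field; rewrite h0 z_neq0.
Qed.

Lemma gen_solution0 (c k : int) :
  gen_solution c k 0 = if (2 %| (k - c))%Z then z ^ k else 0.
Proof.
rewrite /gen_solution /hyperbolic /cosh /sinh !(mulr0, mul0r) oppr0 expR0.
case: ifP => _; rewrite subrr !(mul0r, mulr0, mul1r, addr0)//.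
by rewrite divff ?mulr1 ?pnatr_eq0.
Qed.

(** Apart from [z ^ k], only two continuous functions of time occur, so compactness of [0, t] gives
    a constant independent of [k]. *)
Lemma gen_solution_bounded (c : int) (t : R) : 0 <= t ->
  exists2 A : R, 0 <= A & forall k s, 0 <= s <= t ->
    `|gen_solution c k s| <= `|z ^ k| * A.
Proof.
move=> t0.
have bd H D A : exists2 M : R, 0 <= M & forall s : R, 0 <= s <= t ->
    `|hyperbolic (lambda + mu) H A D s| <= M.
  set f := hyperbolic _ _ _ _.
  have fc : continuous (fun s => `|f s|).
    move=> x; apply: continuous_comp; first exact: hyperbolic_continuous.
    exact: norm_continuous.
  have [x _ fx] := EVT_max t0 (continuous_subspaceT fc).
  by exists `|f x| => // s st; apply: fx; rewrite in_itv.
have [A1 A10 H1] := bd (h / z) (z * (r (c + 1) - r c) / h) 1.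
have [A2 A20 H2] := bd (h / z) (r (c + 1) * (z ^+ 2 + 1) / h) 0.
exists (A1 + A2); first by rewrite addr_ge0.
move=> k s st; rewrite /gen_solution normrM ler_wpM2l//.
by have := H1 s st; have := H2 s st; case: ifP => _; lra.
Qed.

End CandidateSolution.

(** * Two-sided series of constant sign *)

Section BilateralSeries.
Context {R : realType}.

(** Each half has nondecreasing partial sums, dominated by the joint ones and hence by [l]. *)
Let bilateral_cvg_nonneg (a : int -> R) (l : R) : (forall j, 0 <= a j) ->
  (fun n => series (fun j : nat => a j%:Z) n +
    series (fun j : nat => a (- (j.+1)%:Z)) n) @ \oo --> l ->
  bilateral_cvg a.
Proof.
set u := series _; set v := series _ => a0 uvl.
have nd b : (forall j, 0 <= b j) -> nondecreasing_seq (series b : R ^nat).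
  by move=> b0; apply/nondecreasing_seqP => n; rewrite seriesSr lerDl.
have ndu : nondecreasing_seq u by apply: nd.
have ndv : nondecreasing_seq v by apply: nd.
have u0 n : 0 <= u n by apply: sumr_ge0.
have v0 n : 0 <= v n by apply: sumr_ge0.
have uv_le n : u n + v n <= l.
  have <- := cvg_lim (@Rhausdorff R) uvl.
  apply: (nondecreasing_cvgn_le (u_ := fun n => u n + v n)).
    by move=> i j ij; rewrite lerD// ?ndu ?ndv.
  by apply/cvg_ex; exists l.
split; apply: nondecreasing_is_cvgn => //; exists l => _ [n _ <-].
  by apply: le_trans (uv_le n); rewrite lerDl.
by apply: le_trans (uv_le n); rewrite lerDr.
Qed.

(* Summation over growing symmetric windows does not suffice for two-sided
   convergence in general; a constant sign makes it sufficient. *)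
Lemma bilateral_constant_sign (a : int -> R) (l : R) :
  (forall j, 0 <= a j) \/ (forall j, a j <= 0) ->
  (fun n => series (fun j : nat => a j%:Z) n +
    series (fun j : nat => a (- (j.+1)%:Z)) n) @ \oo --> l ->
  bilateral_cvg a /\ bilateral_sum a = l.
Proof.
move=> sgn al; suff [ca cb] : bilateral_cvg a.
  split; first by split.
  rewrite /bilateral_sum -limD//.
  exact: (cvg_lim (@Rhausdorff R) al).
case: sgn => a0; first exact: bilateral_cvg_nonneg a0 al.
have [] : bilateral_cvg (fun j => - a j).
  apply: (@bilateral_cvg_nonneg _ (- l)); first by move=> j; rewrite oppr_ge0.
  apply: cvg_trans (cvgN al); apply: near_eq_cvg; near=> n.
  by rewrite /series/= !sumrN -opprD.
rewrite /bilateral_cvg.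
rewrite (_ : (fun j : nat => - a j%:Z) = - (fun j : nat => a j%:Z))//.
rewrite (_ : (fun j : nat => - a (- (j.+1)%:Z)) =
  - (fun j : nat => a (- (j.+1)%:Z)))//.
by rewrite !seriesN !is_cvgNE.
Unshelve. all: by end_near. Qed.

End BilateralSeries.

(** * Finite windows of the generating functions *)

Section WindowSums.
Context {R : realType}.

(** Common form of [F_term] ([c = 0]) and [G_term] ([c = 1]). *)
Definition parity_term (p : R -> int -> int -> R) (c k : int) (z t : R)
    (j : int) : R :=
  z ^ (2 * j + c) * p t k (2 * j + c).

(** The index runs over [- J <= j < J], so the retained states reach from [c - 2J] to
    [c + 2J - 2]. *)
Definition window_sum (p : R -> int -> int -> R) (c : int) (z : R) (J : nat)
    (k : int) (t : R) : R :=
  series (fun j : nat => parity_term p c k z t j%:Z) J +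
  series (fun j : nat => parity_term p c k z t (- (j.+1)%:Z)) J.

Lemma window_sum0 p c z k t : window_sum p c z 0 k t = 0.
Proof. by rewrite /window_sum /series /= !big_nil addr0. Qed.

Lemma window_sumS p c z J k t : window_sum p c z J.+1 k t =
  window_sum p c z J k t + (parity_term p c k z t J%:Z +
    parity_term p c k z t (- (J.+1)%:Z)).
Proof. by rewrite /window_sum !seriesSr addrACA. Qed.

Lemma window_sum_backward (r : int -> R) p c z J :
  (forall n, backward_solution r (fun k t => p t k n)) ->
  backward_solution r (window_sum p c z J).
Proof.
move=> psol; elim: J => [|J IH].
  rewrite (_ : window_sum _ _ _ _ = fun _ _ => 0).
    exact: backward_solution0.
  by apply/funext => k; apply/funext => t; rewrite window_sum0.
rewrite (_ : window_sum _ _ _ _ = fun k t => window_sum p c z J k t +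
    (parity_term p c k z t J%:Z + parity_term p c k z t (- (J.+1)%:Z))).
  apply: backward_solutionD => //.
  by apply: backward_solutionD; apply: backward_solutionZ.
by apply/funext => k; apply/funext => t; rewrite window_sumS.
Qed.

Lemma window_sum_init p c z J k :
  (forall k n, p 0 k n = (n == k)%:R) ->
  window_sum p c z J k 0 =
    if (2 %| k - c)%Z && (- (2 * J)%:Z <= k - c < (2 * J)%:Z) then z ^ k else 0.
Proof.
move=> p0; have term0 j : parity_term p c k z 0 j =
    if 2 * j + c == k then z ^ k else 0.
  by rewrite /parity_term p0; case: eqP => [->|_]; rewrite ?mulr1 ?mulr0.
elim: J => [|J IH].
  by rewrite window_sum0; case: ifP => //; lia.
rewrite window_sumS IH !term0.
by do ![case: ifP] => //; rewrite ?addr0 ?add0r//; lia.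
Qed.

(** Dominating both [|z|] and its inverse covers exponents of either sign. *)
Lemma norm_exprz_le (z zeta : R) (n : int) : 1 <= zeta ->
  `|z| <= zeta -> `|z|^-1 <= zeta -> `|z ^ n| <= zeta ^+ `|n|.
Proof.
move=> z1 zz iz; case: n => n.
  by rewrite -exprnP normrX absz_nat lerXn2r ?nnegrE// (le_trans ler01).
rewrite NegzE -exprnN abszN absz_nat normfV normrX -exprVn lerXn2r ?nnegrE//.
by rewrite (le_trans ler01).
Qed.

(** There are [2 * J] terms, and [0 <= c <= 1] keeps every exponent within [2 * J] in absolute
    value. Probabilities are bounded merely by 1. *)
Lemma window_sum_norm_le p c z zeta J k t :
  1 <= zeta -> `|z| <= zeta -> `|z|^-1 <= zeta -> 0 <= c <= 1 ->
  (forall n, 0 <= p t k n <= 1) ->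
  `|window_sum p c z J k t| <= (2 * J)%:R * zeta ^+ (2 * J).
Proof.
move=> z1 zz iz c01 p01.
have z0 : 0 <= zeta by rewrite (le_trans ler01).
have termle j : (`|(2 * j + c)%R| <= 2 * J)%N ->
    `|parity_term p c k z t j| <= zeta ^+ (2 * J).
  move=> jJ; rewrite /parity_term normrM; have /andP[p0 p1] := p01 (2 * j + c).
  rewrite (ger0_norm p0) (le_trans (ler_piMr _ p1))//.
  by rewrite (le_trans (norm_exprz_le _ z1 zz iz))// ler_weXn2l.
have half (a : nat -> R) : (forall j, (j < J)%N -> `|a j| <= zeta ^+ (2 * J)) ->
    `|series a J| <= J%:R * zeta ^+ (2 * J).
  move=> aj; rewrite /series /= big_mkord (le_trans (ler_norm_sum _ _ _))//.
  rewrite mulr_natl -[X in _ *+ X]card_ord -sumr_const ler_sum// => i _.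
  exact: aj.
rewrite /window_sum mul2n -addnn natrD mulrDl (le_trans (ler_normD _ _))//.
rewrite addnn -mul2n lerD// half// => j jJ; apply: termle; lia.
Qed.

End WindowSums.

(** * Identification of the generating functions of the chain *)

Section GeneratingFunctions.
Context {R : realType} {d : measure_display} {T : measurableType d}.
Variables (lambda mu : R) (P : int -> probability T R) (N : R -> T -> int).
Hypotheses (lambda_gt0 : 0 < lambda) (mu_gt0 : 0 < mu).
Hypothesis N_ctmc : is_ctmc (alt_generator lambda mu) P N.
Variable z : R.
Hypothesis z_neq0 : z != 0.

Local Notation p := (transition_prob P N).
Local Notation r := (alt_rate lambda mu).

Let frozen_prob (t : R) (k n : int) : R :=
  freeze_negative_times (fun s => p s k n) t.

(** A bootstrap: boundedness of the right-hand side gives continuity of every transition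
    probability, hence of the right-hand side, which then is a two-sided derivative. *)
Lemma transition_prob_backward (n : int) :
  backward_solution r (fun k t => frozen_prob t k n).
Proof.
have cont k : continuous (fun t => frozen_prob t k n).
  apply: (uniform_right_derivative_continuous
    (backward_equation_uniform N_ctmc k n) (K := r k * 4)) => s s0.
  have /andP[rk0 _] := alt_rate_ge0_le lambda_gt0 mu_gt0 k.
  rewrite normrM (ger0_norm rk0) ler_wpM2l// ler_norml.
  have := transition_prob_le1 N_ctmc k n s0.
  have := transition_prob_le1 N_ctmc (k + 1) n s0.
  have := transition_prob_le1 N_ctmc (k - 1) n s0.
  have := transition_prob_ge0 P N s k n.
  have := transition_prob_ge0 P N s (k + 1) n.
  have := transition_prob_ge0 P N s (k - 1) n.
  by move=> *; apply/andP; split; lra.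
split=> // k s s0.
have -> : r k * (frozen_prob s (k + 1) n + frozen_prob s (k - 1) n -
    2 * frozen_prob s k n) =
    r k * (p s (k + 1) n + p s (k - 1) n - 2 * p s k n).
  by rewrite /frozen_prob /freeze_negative_times (max_l (ltW s0)).
apply: (uniform_right_derivative_is_derive
  (backward_equation_uniform N_ctmc k n) s0) => x.
apply: cvgM; first exact: cvg_cst.
apply: cvgB; first by apply: cvgD; exact: cont.
by apply: cvgM; [exact: cvg_cst | exact: cont].
Qed.

(** In a window of radius [2 * J], a state with [|k| <= J] is at least [J] steps from the boundary,
    so [window_bound] applies with [m = J]; the factorial of [J] beats the exponential size of the
    window sums. *)
Lemma window_sum_cvg (c k : int) (t : R) : 0 <= c <= 1 -> 0 <= t ->
  (window_sum p c z J k t) @[J --> \oo] --> gen_solution lambda mu z c k t.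
Proof.
move=> c01 t0.
pose zeta := Num.max 1 (Num.max `|z| `|z|^-1).
have z1 : 1 <= zeta by rewrite /zeta le_max lexx.
have zz : `|z| <= zeta by rewrite /zeta !le_max lexx orbT.
have iz : `|z|^-1 <= zeta by rewrite /zeta !le_max lexx !orbT.
have zeta0 : 0 <= zeta by rewrite (le_trans ler01).
have [A A0 gA] := gen_solution_bounded lambda mu z c t0.
pose C := lambda + mu.
have C0 : 0 < C by rewrite addr_gt0.
pose W J l s :=
  window_sum frozen_prob c z J l s - gen_solution lambda mu z c l s.
have frozenE s l n : 0 <= s -> frozen_prob s l n = p s l n.
  by move=> s0; rewrite /frozen_prob /freeze_negative_times max_l.
have frozen01 s l n : 0 <= frozen_prob s l n <= 1.
  rewrite /frozen_prob /freeze_negative_times transition_prob_ge0.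
  by rewrite (transition_prob_le1 N_ctmc)// le_max lexx orbT.
have Wsol J : backward_solution r (W J).
  apply: backward_solutionB; last exact: gen_solution_backward.
  exact/window_sum_backward/transition_prob_backward.
have Wbound J m l s : (`|l| + m <= 2 * J)%N -> 0 <= s <= t -> `|W J l s| <=
    ((1 + A) * (4 * zeta ^+ 2) ^+ J) * ((2 * C) ^+ m / m`!%:R) * s ^+ m.
  apply: (@window_bound _ (W J) r).
  - exact: alt_rate_ge0_le.
  - by rewrite mulr_ge0 ?addr_ge0// exprn_ge0// mulr_ge0// exprn_ge0.
  - by have [] := Wsol J.
  - by move=> n x /andP[x0 _]; have [_] := Wsol J; exact.
  (* For [|n| < 2 * J] and [c] equal to 0 or 1, a state of the right parity has [n - c] in the
     half-open window, so both initial values agree. *)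
  - move=> n nJ; rewrite /W window_sum_init; last first.
      by move=> ? ?; rewrite frozenE// (transition_prob0 N_ctmc).
    rewrite gen_solution0//; case: ifP; case: ifP; rewrite ?subrr//; lia.
  - move=> n x nJ xt; rewrite /W (le_trans (ler_normB _ _))//.
    (* The factor 4 is chosen so that [2 ^ (2 * J)] absorbs the number [2 * J] of terms. *)
    have -> : (4 * zeta ^+ 2) ^+ J = (2 ^ (2 * J))%:R * zeta ^+ (2 * J).
      by rewrite exprMn -exprM natrX (exprM 2%:R) -natrX.
    rewrite mulrDl mul1r lerD//.
      rewrite (le_trans (window_sum_norm_le (zeta := zeta) _ _ _ _ _ _))//.
      by rewrite ler_wpM2r ?exprn_ge0// ler_nat ltnW// ltn_expl.
    rewrite (le_trans (gA _ _ xt))// mulrC ler_wpM2l//.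
    rewrite (le_trans (norm_exprz_le _ z1 zz iz))//.
    rewrite (le_trans (ler_weXn2l z1 nJ))// ler_peMl ?exprn_ge0//.
    by rewrite ler1n expn_gt0.
apply/cvgrPdist_le => e e0.
have e0A : 0 < e / (1 + A) by rewrite divr_gt0// ltr_wpDr.
(* At [m = J] the bound is [1 + A] times the [J]-th term of this exponential series. *)
have /cvgrPdist_le/(_ _ e0A) := cvg_exp_coeff (4 * zeta ^+ 2 * (2 * C) * t).
move=> Hexp; near=> J; rewrite distrC.
have -> : window_sum p c z J k t = window_sum frozen_prob c z J k t.
  by rewrite /window_sum /parity_term; congr (_ + _);
    apply: eq_bigr => i _; rewrite frozenE.
have kJ : (`|k| + J <= 2 * J)%N.
  have : (`|k| <= J)%N by near: J; exact: nbhs_infty_ge.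
  lia.
have tt : 0 <= t <= t by rewrite t0 lexx.
apply: le_trans (Wbound _ _ _ _ kJ tt) _.
have : `|0 - exp_coeff (4 * zeta ^+ 2 * (2 * C) * t) J| <= e / (1 + A).
  by near: J; exact: Hexp.
rewrite sub0r normrN => /(le_trans (ler_norm _)).
rewrite ler_pdivlMr ?ltr_wpDr//; apply: le_trans.
by rewrite /exp_coeff /= !exprMn le_eqVlt; apply/orP; left; apply/eqP; ring.
Unshelve. all: by end_near. Qed.

(** Since [z ^ (2 * j + c)] is [z ^ c] times a square, all terms share the sign of [z ^ c], even for
    negative [z]; convergence of symmetric windows is then enough. *)
Lemma bilateral_parity_term (c k : int) (t : R) : 0 <= c <= 1 -> 0 <= t ->
  bilateral_cvg (parity_term p c k z t) /\
  bilateral_sum (parity_term p c k z t) = gen_solution lambda mu z c k t.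
Proof.
move=> c01 t0; apply: bilateral_constant_sign; last exact: window_sum_cvg.
have termE j : parity_term p c k z t j =
    z ^ c * ((z ^ j) ^+ 2 * p t k (2 * j + c)).
  rewrite /parity_term addrC expfzDr// mulrA; congr (_ * _ * _).
  by rewrite mulrC -exprz_exp.
have pos j : 0 <= (z ^ j) ^+ 2 * p t k (2 * j + c).
  by rewrite mulr_ge0 ?sqr_ge0 ?transition_prob_ge0.
have [zc|zc] := leP 0 (z ^ c); [left | right] => j; rewrite termE.
  by rewrite mulr_ge0.
by rewrite mulr_le0_ge0// ltW.
Qed.

End GeneratingFunctions.

Theorem mainTheorem4 (R : realType) (d : measure_display) (T : measurableType d)
    (lambda mu : R) (P : int -> probability T R) (N : R -> T -> int)
    (lambda_gt0 : 0 < lambda) (mu_gt0 : 0 < mu)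
    (N_ctmc : is_ctmc (alt_generator lambda mu) P N)
    (k : int) (t z : R) (t_ge0 : 0 <= t) (z_neq0 : z != 0) :
  let p := transition_prob P N in
  let h := alt_h lambda mu in
  (bilateral_cvg (F_term p k z t) /\ bilateral_cvg (G_term p k z t)) /\
  [/\ F_gen p (2 * k) z t =
        expR (- (lambda + mu) * t) * (z ^ (2 * k) / h z) *
        (h z * cosh (t * h z / z) + z * (mu - lambda) * sinh (t * h z / z)),
      G_gen p (2 * k) z t =
        expR (- (lambda + mu) * t) * (z ^ (2 * k) / h z) *
        (lambda * (z ^+ 2 + 1) * sinh (t * h z / z)),
      F_gen p (2 * k + 1) z t =
        expR (- (lambda + mu) * t) * (z ^ (2 * k + 1) / h z) *
        (mu * (z ^+ 2 + 1) * sinh (t * h z / z)) &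
      G_gen p (2 * k + 1) z t =
        expR (- (lambda + mu) * t) * (z ^ (2 * k + 1) / h z) *
        (h z * cosh (t * h z / z) + z * (lambda - mu) * sinh (t * h z / z))].
Proof.
move=> p h.
have FE l : F_term p l z t = parity_term p 0 l z t.
  by apply/funext => j; rewrite /F_term /parity_term addr0.
have gen c l (c01 : 0 <= c <= 1) :=
  bilateral_parity_term lambda_gt0 mu_gt0 N_ctmc z_neq0 l c01 t_ge0.
have h0 : h z != 0 by rewrite gt_eqF// alt_h_gt0.
have r0 : alt_rate lambda mu 0 = lambda by [].
have r1 : alt_rate lambda mu 1 = mu by [].
(* For [c = 1] the opposite parity is represented by [c + 1 = 2], an even state. *)
have r2 : alt_rate lambda mu 2 = lambda by [].
split.
  by split; [rewrite FE; exact: (gen 0 k _).1 | exact: (gen 1 k _).1].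
rewrite /F_gen !FE /G_gen !(gen 0 _ _).2// !(gen 1 _ _).2//.
rewrite /gen_solution /hyperbolic -/h !mulrA.
have -> : (2 %| 2 * k - 0)%Z by lia.
have -> : (2 %| 2 * k + 1 - 1)%Z by lia.
have -> : (2 %| 2 * k + 1 - 0)%Z = false by lia.
have -> : (2 %| 2 * k - 1)%Z = false by lia.
rewrite add0r r0 r1 r2.
by split; field.
Qed.
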